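(* For every $k\ge1$, there exist a binary stochastic process $\{W_t\}_{t\ge1}$ (alphabet $\mathcal W=\{0,1\}$) and a time $t$ such that $S_{t+1}^{(k)}$ is not measurable with respect to $\sigma(S_t^{(k)},W_{t+1})$. Consequently, there is no measurable map $$\Gamma_{k,t}:\mathcal P(\mathcal W^k)\times\mathcal W\to\mathcal P(\mathcal W^k)$$ satisfying $$S_{t+1}^{(k)}=\Gamma_{k,t}\left(S_t^{(k)},W_{t+1}\right)\qquad\text{almost surely}.$$
   Context: For a stochastic process $\{W_t\}_{t\ge1}$ on a standard Borel alphabet $\mathcal W$, let $H_t=W_{1:t}=(W_1,\dots,W_t)$ be the history up to time $t$. The $k$-step predictive state at time $t$ is the conditional law of the next $k$ observations given the history, $$S_t^{(k)}\triangleq P_{W_{t+1:t+k}\mid H_t}(\,\cdot\mid H_t)\in\mathcal P(\mathcal W^k).$$ $\mathcal P(\mathcal W^k)$ is the space of probability measures on $\mathcal W^k$ with the evaluation $\sigma$-field (generated by the maps $\mu\mapsto\mu(A)$). *)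

(* Defs.v *)
From HB Require Import structures.
From mathcomp Require Import all_boot all_order all_algebra.
From mathcomp Require Import all_classical all_reals all_analysis.

Set Implicit Arguments.
Unset Strict Implicit.
Unset Printing Implicit Defensive.

Local Open Scope classical_set_scope.
Local Open Scope ring_scope.

(* Y is measurable with respect to the sigma-algebra sigma(X). *)
Definition measurable_wrt (T : pointedType) (d1 d2 : measure_display)
    (T1 : measurableType d1) (T2 : measurableType d2)
    (X : T -> T1) (Y : T -> T2) : Prop :=
  measurable_fun [set: g_sigma_algebra_preimageType X]
    (Y : g_sigma_algebra_preimageType X -> T2).

(* S is a version of the regular conditional law P(Y \in . | X). The type
   pprobability T2 R carries the sigma-algebra generated by the evaluations
   mu |-> mu B. *)
Definition conditional_law (R : realType) (d d1 d2 : measure_display)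
    (T : measurableType d) (T1 : measurableType d1) (T2 : measurableType d2)
    (P : probability T R) (X : T -> T1) (Y : T -> T2)
    (S : T -> pprobability T2 R) : Prop :=
  measurable_wrt X S /\
  forall (A : set T1) (B : set T2), measurable A -> measurable B ->
    (\int[P]_(w in X @^-1` A) (S w B) = P (X @^-1` A `&` Y @^-1` B))%E.

Section process.
Context {R : realType} {d d' : measure_display}.
Context {T : measurableType d} {A : measurableType d'} {P : probability T R}.

(* The process is (W n) for n >= 1; the value W 0 is never used. *)
Variable W : nat -> {RV P >-> A}.

Definition history (t : nat) (w : T) : t.-tuple A :=
  [tuple W i.+1 w | i < t].

Definition future (k t : nat) (w : T) : k.-tuple A :=
  [tuple W (t + i.+1)%N w | i < k].

(* As a conditional law, the predictive state is only determined up to a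
   P-null set; S is one of its versions. *)
Definition predictive_state (k t : nat)
    (S : T -> pprobability (k.-tuple A) R) : Prop :=
  conditional_law P (history t) (future k t) S.

End process.

Arguments predictive_state {R d d' T A P} W k t S.

(* Main.v *)
(** Let [W_1] be a fair bit, [W_{k+2} = W_1], and let every other observation
    vanish. The window [2, k+1] seen from time 1 is constant, so [S_1] is
    constant and [W_2] carries no information; but the window [3, k+2] seen from
    time 2 contains the copy of [W_1], so [S_2] is the Dirac mass at a point
    that depends on [W_1]. Both outcomes of [W_1] have positive probability,
    which makes the versions of the predictive states unique everywhere. *)

Require Import Defs.
From HB Require Import structures.
From mathcomp Require Import all_boot all_order all_algebra.
From mathcomp Require Import all_classical all_reals all_analysis.
From mathcomp Require Import measurable_realfun.

Import Order.TTheory GRing.Theory Num.Theory.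

Local Open Scope classical_set_scope.
Local Open Scope ring_scope.

Lemma measurable_wrt_comp (T : pointedType) (d1 d2 : measure_display)
    (T1 : measurableType d1) (T2 : measurableType d2)
    (X : T -> T1) (g : T1 -> T2) :
  measurable_fun [set: T1] g -> measurable_wrt X (g \o X).
Proof.
move=> mg _ B mB; rewrite setTI; exists (g @^-1` B); last by rewrite setTI.
by rewrite -[_ @^-1` _]setTI; exact: mg.
Qed.

(** Every set of the sigma-algebra of [X] is a preimage under [X], so it cannot separate two points
    where [X] agrees. *)
Lemma measurable_wrt_eq (T : pointedType) (d1 d2 : measure_display)
    (T1 : measurableType d1) (T2 : measurableType d2)
    (X : T -> T1) (Y : T -> T2) (v w : T) (B : set T2) :
  measurable_wrt X Y -> measurable B -> X v = X w -> B (Y v) -> B (Y w).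
Proof.
move=> mY mB Xvw BYv; have [] := mY measurableT B mB.
move=> C mC; rewrite !setTI => CB.
have : (Y @^-1` B) v by [].
by rewrite -CB /= Xvw => Cw; have : (Y @^-1` B) w by rewrite -CB.
Qed.

Lemma measurable_fun_pprobability (R : realType) (d1 d2 : measure_display)
    (T1 : measurableType d1) (T2 : measurableType d2)
    (f : T1 -> pprobability T2 R) :
  (forall B, measurable B -> measurable_fun [set: T1] (f^~ B : T1 -> \bar R)) ->
  measurable_fun [set: T1] f.
Proof.
move=> mf.
apply: (measurability (@pset _ _ _ : set (set (pprobability _ R)))) => //.
move=> _ -[_ [r r01] [B mB <-]] <-.
by apply: emeasurable_fun_infty_o => //; exact: mf.
Qed.

(** This is a generator of the evaluation sigma-algebra; the threshold 1 separates Dirac masses at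
    points outside [B] from those at points of [B]. *)
Lemma measurable_mset (R : realType) (d : measure_display)
    (T : measurableType d) (B : set T) :
  measurable B ->
  measurable ([set mu | mu B < 1%:E]%E : set (pprobability T R)).
Proof.
move=> mB; apply: sub_sigma_algebra; exists 1; last by exists B.
by rewrite /= in_itv/= ler01 lexx.
Qed.

(** Knowing [X] determines [g \o X], so the integrand is the indicator of an event. This gives
    existence of the predictive states. *)
Lemma conditional_law_dirac (R : realType) (d d1 d2 : measure_display)
    (T : measurableType d) (T1 : measurableType d1) (T2 : measurableType d2)
    (P : probability T R) (X : T -> T1) (g : T1 -> T2) :
  measurable_fun [set: T] X -> measurable_fun [set: T1] g ->
  conditional_law P X (g \o X)
    (fun w => (\d_(g (X w)) : pprobability T2 R)).
Proof.
move=> mX mg; split.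
  apply: (@measurable_wrt_comp _ _ _ _ _ X
    (fun x => (\d_(g x) : pprobability T2 R))).
  apply: measurable_fun_pprobability => B mB.
  exact: (measurableT_comp (@measurable_fun_dirac _ _ R setT _ mB) mg).
move=> A B mA mB.
have mXA : measurable (X @^-1` A) by rewrite -[_ @^-1` _]setTI; exact: mX.
have mgB : measurable ((g \o X) @^-1` B).
  by rewrite -[_ @^-1` _]setTI; exact: (measurableT_comp mg mX).
by rewrite setIC -integral_indic.
Qed.

(** Over the atom the integral is [S w B * P [set w]], and the positive finite factor cancels. Every
    version is thus fixed at [w] itself, not only almost everywhere. *)
Lemma conditional_law_atom (R : realType) (d d1 d2 : measure_display)
    (T : measurableType d) (T1 : measurableType d1) (T2 : measurableType d2)
    (P : probability T R) (X : T -> T1) (Y : T -> T2)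
    (S : T -> pprobability T2 R) (A : set T1) (w : T) :
  conditional_law P X Y S -> measurable A -> measurable [set w] ->
  X @^-1` A = [set w] -> P [set w] != 0%E ->
  forall B, measurable B -> S w B = \d_(Y w) B.
Proof.
move=> [_ SE] mA mw XA Pw B mB; have := SE A B mA mB.
rewrite XA (eq_integral (cst (S w B))); last by move=> x /[!inE] ->.
have Pfin : P [set w] \is a fin_num by rewrite fin_num_measure.
rewrite integral_cst// diracE.
have -> : P ([set w] `&` Y @^-1` B) = ((Y w \in B)%:R%:E * P [set w])%E.
  have [/set_mem YB|/negP YB] := boolP (Y w \in B).
    by rewrite mul1e; congr (P _); apply/seteqP; split=> [x []//|x /= ->].
  rewrite mul0e -[RHS](measure0 P); congr (P _).
  by apply/seteqP; split=> // x [/= ->] /mem_set.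
have Ppos : (0 < P [set w])%E by rewrite lt0e Pw measure_ge0.
by move=> E; apply/le_anti/andP; split; rewrite -(lee_pmul2r Pfin Ppos) E.
Qed.

(* A probability is a function on all sets, measurable or not, so equality on
   the measurable sets would not be enough. *)
Lemma eq_probability (R : realType) (d : measure_display)
    (T : measurableType d) (mu nu : probability T R) :
  (mu = nu :> (set T -> \bar R)) -> mu = nu.
Proof.
case: mu nu => m cm [n cn] /= mn; subst n; congr Probability.Pack.
destruct cm as [[a0 a1] [a2] [a3] [a4] [a5] [a6] [a7]].
destruct cn as [[b0 b1] [b2] [b3] [b4] [b5] [b6] [b7]].
(* The type of [a2] depends on [a0] and [a1], so these are identified first. *)
rewrite (Prop_irrelevance a0 b0) (Prop_irrelevance a1 b1) in a2 *.
by do ![f_equal]; exact: Prop_irrelevance.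
Qed.

(** There are finitely many tuples, and each singleton is a finite intersection of coordinate
    preimages. *)
Lemma measurable_tuple_bool (n : nat) (B : set (n.-tuple bool)) : measurable B.
Proof.
rewrite -(image_id B) -bigcup_imset1.
apply: fin_bigcup_measurable => // t _.
have -> : [set t] =
    \bigcap_(i in [set: 'I_n]) (@tnth n bool ^~ i @^-1` [set tnth t i]).
  apply/seteqP; split=> [u -> //|u ut]; apply: eq_from_tnth => i; exact: ut.
apply: fin_bigcap_measurable => // i _.
by rewrite -[_ @^-1` _]setTI; exact: measurable_tnth.
Qed.

Definition delayed_copy (k n : nat) (b : bool) : bool :=
  ((n == 1) || (n == k.+2))%N && b.

Lemma measurable_delayed_copy (k n : nat) :
  measurable_fun [set: bool] (delayed_copy k n).
Proof. by []. Qed.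

HB.instance Definition _ (k n : nat) :=
  isMeasurableFun.Build _ _ _ _ (delayed_copy k n)
    (measurable_delayed_copy k n).

Lemma bernoulli_half_atom (R : realType) (b : bool) :
  bernoulli_prob (2^-1 : R) [set b] != 0%E.
Proof.
rewrite /bernoulli_prob invr_ge0 ler0n invf_le1// ler1n/= fsbig_set1 eqe.
by case: b; rewrite /= ?subr_eq0 ?invr_eq0 ?pnatr_eq0// eq_sym invr_eq1 pnatr_eq1.
Qed.

(** A null set cannot contain a point of positive mass. *)
Lemma ae_atom (R : realType) (d : measure_display) (T : measurableType d)
    (P : probability T R) (Q : T -> Prop) (w : T) :
  measurable [set w] -> P [set w] != 0%E -> {ae P, forall x, Q x} -> Q w.
Proof.
move=> mw Pw [N [mN PN QN]]; apply: contrapT => nQw.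
move/eqP : Pw; apply; apply/eqP; rewrite -measure_le0 -PN le_measure ?inE//.
by move=> _ ->; exact: QN.
Qed.

Theorem proposition2 (R : realType) (k : nat) (hk : (1 <= k)%N) :
  exists (d : measure_display) (T : measurableType d) (P : probability T R)
    (W : nat -> {RV P >-> bool}) (t : nat),
    [/\ (1 <= t)%N,
        exists S : T -> pprobability (k.-tuple bool) R,
          predictive_state W k t S,
        exists S' : T -> pprobability (k.-tuple bool) R,
          predictive_state W k t.+1 S' &
        forall S S' : T -> pprobability (k.-tuple bool) R,
          predictive_state W k t S -> predictive_state W k t.+1 S' ->
          ~ measurable_wrt (fun w => (S w, W t.+1 w)) S' /\
          ~ (exists Gamma : pprobability (k.-tuple bool) R * bool ->
                            pprobability (k.-tuple bool) R,
               measurable_fun [set: pprobability (k.-tuple bool) R * bool]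
                 Gamma /\
               {ae P, forall w, S' w = Gamma (S w, W t.+1 w)})].
Proof.
case: k hk => [//|k] _.
pose P : probability bool R := bernoulli_prob (2^-1 : R).
pose W n : {RV P >-> bool} := delayed_copy k.+1 n.
have W1 w : W 1%N w = w by [].
(* The first entry of a history is the outcome itself, so these events pull back to the atoms of the
   sample space. *)
pose A0 n (w : bool) : set (n.+1.-tuple bool) := [set h | tnth h ord0 = w].
have mA0 n w : measurable (A0 n w) by exact: measurable_tuple_bool.
have XA0 n w : history W n.+1 @^-1` A0 n w = [set w].
  by apply/seteqP; split=> [v|v ->]; rewrite /A0/= tnth_mktuple W1.
have exS n : exists S : bool -> pprobability (k.+1.-tuple bool) R,
    predictive_state W k.+1 n.+1 S.
  (* The first entry of the history recovers the outcome, hence the whole future. *)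
  pose g (h : n.+1.-tuple bool) := future W k.+1 n.+1 (tnth h ord0).
  exists (fun w =>
    (\d_(g (history W n.+1 w)) : pprobability (k.+1.-tuple bool) R)).
  rewrite /predictive_state.
  have -> : future W k.+1 n.+1 = g \o history W n.+1.
    by apply/funext => w; rewrite /g/= tnth_mktuple W1.
  apply: conditional_law_dirac => //.
  by apply: (measurableT_comp _ (measurable_tnth _)).
exists _, bool, P, W, 1%N; split=> // S S' hS hS'.
have SE n (S0 : bool -> pprobability (k.+1.-tuple bool) R) w :
    predictive_state W k.+1 n.+1 S0 -> S0 w = \d_(future W k.+1 n.+1 w).
  move=> hS0; apply: eq_probability; apply/funext => B.
  apply: (conditional_law_atom _ _ _ _ _ _ _ _ _ _ _ _ _ hS0 (mA0 n w)) => //.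
  - exact: XA0.
  - exact: bernoulli_half_atom.
  - exact: measurable_tuple_bool.
(* With [k.+1] as window length the copy sits at time [k.+3]; the window from time 1 ends at [k.+2],
   one step short. *)
have future1 : future W k.+1 1 true = future W k.+1 1 false.
  apply: eq_from_tnth => i; rewrite !tnth_mktuple /W /= /delayed_copy.
  by rewrite andbT andbF add1n /= !eqSS ltn_eqF.
(* The window from time 2 ends exactly at [k.+3], so its last entry is the copy. *)
have futureE w : tnth (future W k.+1 2 w) ord_max = w.
  by rewrite tnth_mktuple /W /= /delayed_copy add2n eqxx orbT.
have S01 : S true = S false by rewrite !(SE _ _ _ hS) future1.
have W2 : W 2%N true = W 2%N false by [].
pose B := [set h : k.+1.-tuple bool | tnth h ord_max].
have mB : measurable B by exact: measurable_tuple_bool.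
have S'B w : S' w B = (w%:R)%:E.
  transitivity (\d_(future W k.+1 2 w) B : \bar R).
    by rewrite (SE _ _ _ hS').
  rewrite diracE; congr ((nat_of_bool _)%:R%:E).
  by rewrite -[RHS](futureE w); apply/idP/idP => [/set_mem|/mem_set].
split.
  move=> mS'.
  have := measurable_wrt_eq _ _ _ _ _ _ _ false true _ mS'
    (measurable_mset R _ _ B mB).
  rewrite /= !S'B ltxx => h; suff : false by [].
  by apply: h; rewrite ?S01 ?W2// lte_fin ltr01.
move=> [Gamma [_ aeG]].
(* Both outcomes are atoms, so the almost sure identity holds at each; [Gamma] then receives the
   same input at [true] and [false]. *)
have G w : S' w = Gamma (S w, W 2%N w).
  exact: (ae_atom _ _ _ P (fun w => S' w = Gamma (S w, W 2%N w)) w _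
    (bernoulli_half_atom R w) aeG).
have : S' true B = S' false B by rewrite !G S01 W2.
by rewrite !S'B => /eqP; rewrite eqe oner_eq0.
Qed.
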